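(* Two families of systems in prenormal form (case $k=1$) are formally equivalent if and only if they have the same model system. Hence the complete system of formal invariants of a family in prenormal form $(x^2-\epsilon)y'=(\Lambda(\epsilon,x)+(x^2-\epsilon)R(\epsilon,x))y$ is given by the $n$ polynomials $\lambda_i(\epsilon,x)$, $i=1,\dots,n$, of degree $1$ in $x$ that are the diagonal entries of $\Lambda(\epsilon,x)$.
   Context: A family in prenormal form (case $k=1$) is a family of linear systems $(x^2-\epsilon)y'=B(\epsilon,x)y$, $y\in\mathbb{C}^n$, $'=d/dx$, $\epsilon\in(\mathbb{C},0)$, $x\in(\mathbb C,0)$, with $B(\epsilon,x)=\Lambda(\epsilon,x)+(x^2-\epsilon)R(\epsilon,x)$, where $\Lambda(\epsilon,x)=\mathrm{diag}\{\lambda_1(\epsilon,x),\dots,\lambda_n(\epsilon,x)\}$, $\lambda_i(\epsilon,x)=\lambda_{i,0}(\epsilon)+\lambda_{i,1}(\epsilon)x$ with $\lambda_{i,q}$ germs of analytic functions of $\epsilon$ at $0$, $R$ is a matrix of germs of analytic functions of $(\epsilon,x)$ at the origin, and $\Re(\lambda_q(0,0)-\lambda_j(0,0))>0$ for $q<j$. Its model system is $(x^2-\epsilon)z'=\Lambda(\epsilon,x)z$. Two families $y'=A_1(\epsilon,x)y$ and $z'=A_2(\epsilon,x)z$ are formally equivalent if there exists an invertible matrix $P(\epsilon,x)$ of formal power series in $(\epsilon,x)$ such that the substitution $y=P(\epsilon,x)z$ transforms one system into the other. *)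

(* Defs.v *)
From HB Require Import structures.
From mathcomp Require Import all_boot all_order all_algebra.
From mathcomp Require Import complex.
From mathcomp Require Import all_classical all_reals all_analysis.

Set Implicit Arguments.
Unset Strict Implicit.
Unset Printing Implicit Defensive.

Import Order.TTheory GRing.Theory Num.Theory.
Import numFieldNormedType.Exports.

Local Open Scope classical_set_scope.
Local Open Scope ring_scope.

(* The complex numbers over R, typed so that the canonical topology of a
   numClosedFieldType is found; CC R is convertible to R[i]. In this field
   [0 < z] means that z is real and positive, and [`|z|] is the modulus. *)
Definition CC (R : realType) : numClosedFieldType := R[i].

Definition reC (R : realType) (z : CC R) : R := complex.Re (z : R[i]).

Section AnalyticGerms.
Variable R : realType.
Notation C := (CC R).

Definition analytic1 (f : C -> C) : Prop :=
  exists (a : nat -> C) (r : C), 0 < r /\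
    forall e : C, `|e| < r -> [series a k * e ^+ k]_k @ \oo --> f e.

(* [expansion2 f a]: f(e, x) = \sum_(k, l) a k l e^k x^l near (0, 0). The
   geometric bound makes the double series absolutely convergent on the
   polydisc of radius r, so that the choice of square partial sums is
   immaterial and a is the Taylor expansion of f at (0, 0). *)
Definition expansion2 (f : C -> C -> C) (a : nat -> nat -> C) : Prop :=
  exists r M : C, [/\ 0 < r,
    forall k l : nat, `|a k l| * r ^+ (k + l) <= M &
    forall e x : C, `|e| < r -> `|x| < r ->
      (fun N : nat => \sum_(k < N) \sum_(l < N) a k l * e ^+ k * x ^+ l)
        @ \oo --> f e x].

Definition analytic2 (f : C -> C -> C) : Prop :=
  exists a : nat -> nat -> C, expansion2 f a.

End AnalyticGerms.

(* Formal power series in (e, x) with coefficients in A: [p k l] is the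
   coefficient of e^k x^l. With A := 'M[C]_n this is the ring of n x n matrices
   of formal power series in (e, x). *)
Section FormalSeries.
Variable A : pzRingType.

Definition fps2 := nat -> nat -> A.

Definition fps2_add (p q : fps2) : fps2 := fun k l => p k l + q k l.

Definition fps2_mul (p q : fps2) : fps2 := fun k l =>
  \sum_(i < k.+1) \sum_(j < l.+1) p i j * q (k - i)%N (l - j)%N.

Definition fps2_one : fps2 := fun k l => ((k == 0) && (l == 0))%N%:R.

Definition fps2_dx (p : fps2) : fps2 := fun k l => p k l.+1 *+ l.+1.

(* the series x^2 - e *)
Definition fps2_x2e : fps2 := fun k l =>
  ((k == 0) && (l == 2))%N%:R - ((k == 1) && (l == 0))%N%:R.

Definition fps2_invertible (p : fps2) : Prop :=
  exists q : fps2, (forall k l, fps2_mul p q k l = fps2_one k l) /\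
                   (forall k l, fps2_mul q p k l = fps2_one k l).

End FormalSeries.

Section Families.
Variables (R : realType) (n : nat).
Notation C := (CC R).

(* A family (x^2 - e) y' = B(e, x) y is represented by B : C -> C -> 'M_n;
   only the germ of B at (0, 0) matters. *)

Definition mx_expansion2 (B : C -> C -> 'M[C]_n) (b : fps2 'M[C]_n) : Prop :=
  forall i j : 'I_n,
    expansion2 (fun e x => B e x i j) (fun k l => b k l i j).

(* Substituting y = P z in (x^2 - e) y' = B1 y, where (x^2 - e) z' = B2 z,
   gives ((x^2 - e) P' + P B2) z = B1 P z. The Taylor expansions b1 and b2 are
   unique when they exist. *)
Definition formally_equivalent (B1 B2 : C -> C -> 'M[C]_n) : Prop :=
  exists b1 b2 : fps2 'M[C]_n,
    [/\ mx_expansion2 B1 b1, mx_expansion2 B2 b2 &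
      exists P : fps2 'M[C]_n, fps2_invertible P /\
        forall k l : nat,
          fps2_add (fps2_mul (@fps2_x2e 'M[C]_n) (fps2_dx P))
                   (fps2_mul P b2) k l
          = fps2_mul b1 P k l].

(* Equality of families as germs: the systems
   y' = (x^2 - e)^-1 B y coincide iff the germs of B at (0, 0) do. *)
Definition same_family (B1 B2 : C -> C -> 'M[C]_n) : Prop :=
  \forall p \near ((0, 0) : C * C), B1 p.1 p.2 = B2 p.1 p.2.

Definition lambda_poly (l0 l1 : C -> C) (e : C) : {poly C} :=
  (l0 e)%:P + l1 e *: 'X.

Record prenormal_family := PrenormalFamily {
  lam0 : 'I_n -> C -> C;
  lam1 : 'I_n -> C -> C;
  remainder : C -> C -> 'M[C]_n;
  lam0_analytic : forall i, analytic1 (lam0 i);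
  lam1_analytic : forall i, analytic1 (lam1 i);
  remainder_analytic : forall i j, analytic2 (fun e x => remainder e x i j);
  lam_ordered : forall q j : 'I_n, (q < j)%N ->
    0 < reC ((lambda_poly (lam0 q) (lam1 q) 0).[0]
             - (lambda_poly (lam0 j) (lam1 j) 0).[0])
}.

(* lambda_i(e, x), as a polynomial in x *)
Definition lambda (F : prenormal_family) (i : 'I_n) (e : C) : {poly C} :=
  lambda_poly (lam0 F i) (lam1 F i) e.

Definition model_system (F : prenormal_family) (e x : C) : 'M[C]_n :=
  diag_mx (\row_(i < n) (lambda F i e).[x]).

Definition family_system (F : prenormal_family) (e x : C) : 'M[C]_n :=
  model_system F e x + (x ^+ 2 - e) *: remainder F e x.

(* Equality of the polynomials lambda_i, whose coefficients are germs in e *)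
Definition same_invariants (F1 F2 : prenormal_family) : Prop :=
  forall i : 'I_n, \forall e \near (0 : C), lambda F1 i e = lambda F2 i e.

End Families.

(* Main.v *)
Require Import Defs.
From HB Require Import structures.
From mathcomp Require Import all_boot all_order all_algebra all_fingroup.
From mathcomp Require Import complex.
From mathcomp Require Import all_classical all_reals all_analysis.

(* Write u = x^2 - e, B_i = D_i + u R_i with D_i diagonal. The equation for the
   gauge transformation P is P D_2 - D_1 P = u (R_1 P - P R_2 - P').
   If P is invertible, then at the origin P intertwines D_2 and D_1, and the
   ordering of the eigenvalues forces the diagonal entries of P to be units; the
   (i, i) entry of the equation then puts the difference of the i-th eigenvalues
   in the ideal (u), which contains no nonzero series of degree <= 1 in x.
   Conversely, if D_1 = D_2, solve the diagonal entries for P' and the others for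
   P_ij, dividing by the difference of eigenvalues, which is a unit. Giving e
   weight 2 and x weight 1, u d/dx and integration in x both raise the weight, so
   that this is a fixpoint problem for a contraction of formal power series.
   On the analytic side, Taylor expansions in (e, x) must be shown unique. *)

Set Implicit Arguments.
Unset Strict Implicit.
Unset Printing Implicit Defensive.

Import Order.TTheory GRing.Theory Num.Theory.
Import numFieldNormedType.Exports.

Local Open Scope classical_set_scope.
Local Open Scope ring_scope.

(** * The ring of formal power series in (e, x) *)

Section FormalRing.
Variable A : pzRingType.
HB.instance Definition _ := GRing.Zmodule.copy (fps2 A) (nat -> nat -> A).
Implicit Types p q r : fps2 A.

Lemma fps2_ext p q : (forall k l, p k l = q k l) -> p = q.
Proof. by move=> pq; apply: funext => k; apply: funext => l. Qed.

Lemma fps2_addE p q k l : (p + q) k l = p k l + q k l. Proof. by []. Qed.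
Lemma fps2_oppE p k l : (- p) k l = - p k l. Proof. by []. Qed.

(** Both sides run over the triples [(a, b, c)] with [a + b + c = k]; the induction splits off the
    triples with [a = 0]. *)
Lemma exchange_triangle (V : nmodType) (F : nat -> nat -> nat -> V) k :
  \sum_(i < k.+1) \sum_(a < i.+1) F a (i - a)%N (k - i)%N =
  \sum_(a < k.+1) \sum_(b < (k - a).+1) F a b (k - a - b)%N.
Proof.
elim: k F => [|k IH] F; first by rewrite !big_ord1.
rewrite big_ord_recl big_ord1 [RHS]big_ord_recl /=.
rewrite [X in _ = X + _]big_ord_recl -addrA.
congr (_ + _).
under eq_bigr do rewrite big_ord_recl.
rewrite big_split /=; congr (_ + _).
rewrite -(IH (fun a b c => F a.+1 b c)).
by apply: eq_bigr => i _; apply: eq_bigr => a _.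
Qed.

Lemma fps2_mulA : associative (@fps2_mul A).
Proof.
move=> p q r; apply: fps2_ext => k l; apply/esym; rewrite /fps2_mul.
(* The exponents of [e] are regrouped first, with the whole sum over exponents of [x] as summand;
   the exponents of [x] follow below. *)
transitivity (\sum_(i < k.+1) \sum_(a < i.+1)
  (fun a b c => \sum_(j < l.+1) \sum_(d < j.+1)
     p a d * q b (j - d)%N * r c (l - j)%N) (a : nat) (i - a)%N (k - i)%N).
  apply: eq_bigr => i _; rewrite exchange_big; apply: eq_bigr => j _.
  by rewrite mulr_suml; apply: eq_bigr => a _; rewrite mulr_suml.
rewrite (exchange_triangle (fun a b c => \sum_(j < l.+1) \sum_(d < j.+1)
     p a d * q b (j - d)%N * r c (l - j)%N)).
apply: eq_bigr => a _.
transitivity (\sum_(b < (k - a).+1) \sum_(j < l.+1) \sum_(d < (l - j).+1)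
   p a j * q b d * r (k - a - b)%N (l - j - d)%N).
  apply: eq_bigr => b _.
  by rewrite (exchange_triangle (fun x y z => p a x * q b y * r (k - a - b)%N z)).
rewrite exchange_big; apply: eq_bigr => j _; rewrite mulr_sumr.
apply: eq_bigr => b _; rewrite mulr_sumr.
by apply: eq_bigr => d _; rewrite mulrA.
Qed.

Lemma fps2_mul1p : left_id (@fps2_one A) (@fps2_mul A).
Proof.
move=> p; apply: fps2_ext => k l; rewrite /fps2_mul /fps2_one.
rewrite big_ord_recl [X in _ + X]big1 ?addr0; last first.
  by move=> i _; rewrite big1 // => j _; rewrite mul0r.
rewrite big_ord_recl big1 ?addr0; first by rewrite mul1r !subn0.
by move=> j _; rewrite mul0r.
Qed.

Lemma fps2_mulp1 : right_id (@fps2_one A) (@fps2_mul A).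
Proof.
move=> p; apply: fps2_ext => k l; rewrite /fps2_mul /fps2_one.
rewrite big_ord_recr /= [X in X + _]big1 ?add0r; last first.
  move=> i _; rewrite big1 // => j _ /=.
  by rewrite subn_eq0 leqNgt ltn_ord mulr0.
rewrite big_ord_recr /= big1 ?add0r; first by rewrite !subnn mulr1.
by move=> j _; rewrite subnn subn_eq0 leqNgt ltn_ord mulr0.
Qed.

Lemma fps2_mulDl : left_distributive (@fps2_mul A) +%R.
Proof.
move=> p q r; apply: fps2_ext => k l; rewrite !fps2_addE /fps2_mul -big_split.
apply: eq_bigr => i _; rewrite -big_split.
by apply: eq_bigr => j _; rewrite fps2_addE mulrDl.
Qed.

Lemma fps2_mulDr : right_distributive (@fps2_mul A) +%R.
Proof.
move=> p q r; apply: fps2_ext => k l; rewrite !fps2_addE /fps2_mul -big_split.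
apply: eq_bigr => i _; rewrite -big_split.
by apply: eq_bigr => j _; rewrite fps2_addE mulrDr.
Qed.

HB.instance Definition _ := GRing.Zmodule_isPzRing.Build (fps2 A)
  fps2_mulA fps2_mul1p fps2_mulp1 fps2_mulDl fps2_mulDr.

Lemma fps2_mulE p q k l : (p * q) k l =
  \sum_(i < k.+1) \sum_(j < l.+1) p i j * q (k - i)%N (l - j)%N.
Proof. by []. Qed.

Lemma fps2_mul00 p q : (p * q) 0%N 0%N = p 0%N 0%N * q 0%N 0%N.
Proof. by rewrite fps2_mulE !big_ord1. Qed.

(* e has weight 2 and x has weight 1, so that x^2 - e is homogeneous. *)
Definition fps2_weight_ge m p := forall k l, (k.*2 + l < m)%N -> p k l = 0.

Lemma fps2_weight_mull m p q : fps2_weight_ge m q -> fps2_weight_ge m (p * q).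
Proof.
move=> q0 k l klm; rewrite fps2_mulE big1 // => i _; rewrite big1 // => j _.
rewrite q0 ?mulr0 //; apply: leq_ltn_trans klm.
by rewrite leq_add ?leq_double ?leq_subr.
Qed.

Lemma fps2_weight_mulr m p q : fps2_weight_ge m q -> fps2_weight_ge m (q * p).
Proof.
move=> q0 k l klm; rewrite fps2_mulE big1 // => i _; rewrite big1 // => j _.
rewrite q0 ?mul0r //; apply: leq_ltn_trans klm.
by rewrite leq_add ?leq_double // -ltnS.
Qed.

(** Every term of the convolution other than the one with [p 0 0] contains a coefficient of [q] of
    weight below [k.*2 + l]. *)
Lemma fps2_mul_leadl p q k l : fps2_weight_ge (k.*2 + l) q ->
  (p * q) k l = p 0%N 0%N * q k l.
Proof.
move=> q0; rewrite fps2_mulE big_ord_recl [X in _ + X]big1 ?addr0; last first.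
  move=> i _; rewrite big1 // => j _; rewrite q0 ?mulr0 //.
  rewrite -addSn leq_add ?leq_subr // ltn_double lift0 ltn_subrL.
  by case: k i q0 => [[]|].
rewrite big_ord_recl big1 ?addr0 /=; first by rewrite !subn0.
move=> j _; rewrite q0 ?mulr0 // subn0 ltn_add2l /bump leq0n add1n ltn_subrL.
by case: l j q0 => [[]|].
Qed.

Lemma fps2_mul_leadr p q k l : fps2_weight_ge (k.*2 + l) q ->
  (q * p) k l = q k l * p 0%N 0%N.
Proof.
move=> q0; rewrite fps2_mulE big_ord_recr /= [X in X + _]big1 ?add0r; last first.
  move=> i _; rewrite big1 // => j _; rewrite q0 ?mul0r //.
  by rewrite -addSn leq_add ?ltn_double // -ltnS.
rewrite big_ord_recr /= big1 ?add0r; first by rewrite !subnn.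
by move=> j _; rewrite q0 ?mul0r // ltn_add2l.
Qed.

(** * Contractions for the weight filtration, and units *)

Definition fps2_contractive (Phi : fps2 A -> fps2 A) := forall m p q,
  fps2_weight_ge m (p - q) -> fps2_weight_ge m.+1 (Phi p - Phi q).

(** This is Banach's fixpoint argument for the weight filtration: each further iterate of [Phi] from
    0 settles the coefficients of one more weight. *)
Lemma fps2_fixpoint Phi : fps2_contractive Phi -> exists p, p = Phi p.
Proof.
move=> ctr; pose it m := iter m Phi 0.
have itS m d : fps2_weight_ge m (it (m + d)%N - it m).
  elim: m => [|m IH]; first by move=> k l.
  by rewrite addSn; exact: ctr.
(* The coefficient at [(k, l)] has weight [k.*2 + l] and no longer changes from the iterate
   [(k.*2 + l).+1] on. *)
pose p : fps2 A := fun k l => it (k.*2 + l).+1 k l.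
have pit m : fps2_weight_ge m (p - it m).
  move=> k l klm; apply/eqP; rewrite fps2_addE fps2_oppE subr_eq0; apply/eqP.
  have /subnKC <- := klm.
  have /(_ k l (ltnSn _)) := itS (k.*2 + l).+1 (m - (k.*2 + l).+1)%N.
  by move/eqP; rewrite fps2_addE fps2_oppE subr_eq0 => /eqP /esym.
exists p; apply: fps2_ext => k l; apply/eqP; rewrite -subr_eq0; apply/eqP.
have := pit (k.*2 + l).+1 k l (ltnSn _).
have := ctr _ _ _ (pit (k.*2 + l)%N) k l (ltnSn _).
rewrite !fps2_addE !fps2_oppE => /eqP; rewrite subr_eq0 => /eqP ->.
by [].
Qed.

(** A right inverse is a fixpoint of [q + c (1 - p q)], which is contractive because [c] cancels the
    constant term of [p]. As [A] may be noncommutative, a left inverse is built separately and then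
    identified with the right one. *)
Lemma fps2_unit p c : c * p 0%N 0%N = 1 -> p 0%N 0%N * c = 1 ->
  exists q, p * q = 1 /\ q * p = 1.
Proof.
move=> cp pc.
pose cst : fps2 A := fun k l => if (k == 0%N) && (l == 0%N) then c else 0.
pose scl := (fun r k l => c * r k l) : fps2 A -> fps2 A.
pose scr := (fun r k l => r k l * c) : fps2 A -> fps2 A.
have [q qE] : exists q, q = q + scl (1 - p * q).
  apply: fps2_fixpoint => m q q' qq' k l; rewrite ltnS => klm.
  have -> : q + scl (1 - p * q) - (q' + scl (1 - p * q')) =
            (q - q') - scl (p * (q - q')).
    apply: fps2_ext => a b; rewrite mulrBr /scl.
    rewrite !(fps2_addE, fps2_oppE) -mulrN.
    rewrite !opprD addrACA -!mulrN -!mulrDr opprK !opprD addrACA subrr add0r.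
    by rewrite opprK.
  (* In the lowest weight, [p * (q - q')] is [p 0 0] times [q - q'], so that the two terms
     cancel. *)
  rewrite fps2_addE fps2_oppE /scl fps2_mul_leadl ?mulrA ?cp ?mul1r ?subrr //.
  by move=> a b ab; apply: qq'; exact: leq_trans ab klm.
have [q' q'E] : exists q, q = q + scr (1 - q * p).
  apply: fps2_fixpoint => m r r' rr' k l; rewrite ltnS => klm.
  have -> : r + scr (1 - r * p) - (r' + scr (1 - r' * p)) =
            (r - r') - scr ((r - r') * p).
    apply: fps2_ext => a b; rewrite mulrBl /scr.
    rewrite !(fps2_addE, fps2_oppE) -mulNr.
    rewrite !opprD addrACA -!mulNr -!mulrDl opprK !opprD addrACA subrr add0r.
    by rewrite opprK.
  rewrite fps2_addE fps2_oppE /scr fps2_mul_leadr -?mulrA ?pc ?mulr1 ?subrr //.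
  by move=> a b ab; apply: rr'; exact: leq_trans ab klm.
have pq : p * q = 1.
  apply: fps2_ext => k l; apply/esym/eqP; rewrite -subr_eq0; apply/eqP.
  (* The fixpoint equation says that [c] kills each coefficient of [1 - p * q]; multiplying by
     [p 0 0] removes [c]. *)
  have /(congr1 (fun r : fps2 A => r k l)) := qE.
  rewrite fps2_addE /scl -[X in X = _]addr0 => /addrI /esym.
  by move/(congr1 ( *%R (p 0%N 0%N))); rewrite mulr0 mulrA pc mul1r.
have q'p : q' * p = 1.
  apply: fps2_ext => k l; apply/esym/eqP; rewrite -subr_eq0; apply/eqP.
  have /(congr1 (fun r : fps2 A => r k l)) := q'E.
  rewrite fps2_addE /scr -[X in X = _]addr0 => /addrI /esym.
  by move/(congr1 ( *%R^~ (p 0%N 0%N))); rewrite mul0r -mulrA cp mulr1.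
have qq' : q = q' by rewrite -[LHS]mul1r -q'p -mulrA pq mulr1.
by exists q; split => //; rewrite qq'.
Qed.

(** * Multiplication by monomials and by [x^2 - e] *)

Definition fps2_mono (a b : nat) : fps2 A := fun k l =>
  ((k == a) && (l == b))%N%:R.

Lemma fps2_mono_mull a b p k l : (fps2_mono a b * p) k l =
  if (a <= k)%N && (b <= l)%N then p (k - a)%N (l - b)%N else 0.
Proof.
rewrite fps2_mulE.
transitivity (\sum_(i < k.+1 | i == a :> nat) \sum_(j < l.+1 | j == b :> nat)
  p (k - i)%N (l - j)%N).
  rewrite [RHS]big_mkcond; apply: eq_bigr => i _; rewrite /fps2_mono.
  case: eqP => _ /=; last by rewrite big1 // => j _; rewrite mul0r.
  rewrite [RHS]big_mkcond; apply: eq_bigr => j _.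
  by case: eqP => _; rewrite ?mul1r ?mul0r.
rewrite (big_ord1_eq _ (fun i => \sum_(j < l.+1 | j == b :> nat)
  p (k - i)%N (l - j)%N)).
rewrite (big_ord1_eq _ (fun j => p (k - a)%N (l - j)%N)) !ltnS.
by case: ifP => //= _; case: ifP.
Qed.

Lemma fps2_mono_mulr a b p k l : (p * fps2_mono a b) k l =
  if (a <= k)%N && (b <= l)%N then p (k - a)%N (l - b)%N else 0.
Proof.
rewrite fps2_mulE (reindex_inj rev_ord_inj) /=.
under eq_bigr do rewrite (reindex_inj rev_ord_inj) /=.
transitivity (\sum_(i < k.+1 | i == a :> nat) \sum_(j < l.+1 | j == b :> nat)
  p (k - i)%N (l - j)%N).
  rewrite [RHS]big_mkcond; apply: eq_bigr => i _; rewrite /fps2_mono.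
  rewrite !subSS subKn -1?ltnS //.
  case: eqP => _ /=; last by rewrite big1 // => j _; rewrite mulr0.
  rewrite [RHS]big_mkcond; apply: eq_bigr => j _; rewrite subSS subKn -1?ltnS //.
  by case: eqP => _; rewrite ?mulr1 ?mulr0.
rewrite (big_ord1_eq _ (fun i => \sum_(j < l.+1 | j == b :> nat)
  p (k - i)%N (l - j)%N)).
rewrite (big_ord1_eq _ (fun j => p (k - a)%N (l - j)%N)) !ltnS.
by case: ifP => //= _; case: ifP.
Qed.

Lemma fps2_x2e_mono : @fps2_x2e A = fps2_mono 0 2 - fps2_mono 1 0.
Proof. by []. Qed.

Lemma fps2_x2e_comm p : (@fps2_x2e A : fps2 A) * p = p * (@fps2_x2e A : fps2 A).
Proof.
apply: fps2_ext => k l; rewrite fps2_x2e_mono mulrBl mulrBr.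
by rewrite !(fps2_addE, fps2_oppE) !fps2_mono_mull !fps2_mono_mulr.
Qed.

Lemma fps2_x2e_mulE p k l : ((@fps2_x2e A : fps2 A) * p) k l =
  (if (1 < l)%N then p k (l - 2)%N else 0) -
  (if (0 < k)%N then p k.-1 l else 0).
Proof.
rewrite fps2_x2e_mono mulrBl !(fps2_addE, fps2_oppE) !fps2_mono_mull /=.
by rewrite subn0 subn0 subn1 andbT.
Qed.

(** The coefficient of the product at [(k, l.+2)] is [p k l] minus, for [k > 0], [p k.-1 l.+2];
    hence [p] vanishes by induction on [k]. Thus a multiple of [x^2 - e] of degree at most 1 in [x]
    is zero. *)
Lemma fps2_x2e_mul_eq0 p :
  (forall k l, ((@fps2_x2e A : fps2 A) * p) k l.+2 = 0) -> p = 0.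
Proof.
move=> up0; apply: fps2_ext; elim=> [|k IH] l.
  by have := up0 0%N l; rewrite fps2_x2e_mulE /= subr0 subn2.
by have := up0 k.+1 l; rewrite fps2_x2e_mulE /= subn2 /= IH subr0.
Qed.

End FormalRing.

Lemma fps2_mulC (A : comPzRingType) (p q : fps2 A) : p * q = q * p.
Proof.
apply: fps2_ext => k l; rewrite !fps2_mulE (reindex_inj rev_ord_inj) /=.
apply: eq_bigr => i _; rewrite (reindex_inj rev_ord_inj) /=.
apply: eq_bigr => j _; rewrite mulrC !subSS !subKn // -ltnS //.
Qed.

(** * Matrices of series, entry by entry *)

Section MatrixSeries.
Variables (A : comPzRingType) (n : nat).
Implicit Types P Q : fps2 'M[A]_n.

Definition fps2_entry (i j : 'I_n) P : fps2 A := fun k l => P k l i j.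

Lemma fps2_entryD i j P Q :
  fps2_entry i j (P + Q) = fps2_entry i j P + fps2_entry i j Q.
Proof.
by apply: fps2_ext => k l; rewrite /fps2_entry !fps2_addE mxE.
Qed.

Lemma fps2_entryN i j P : fps2_entry i j (- P) = - fps2_entry i j P.
Proof.
by apply: fps2_ext => k l; rewrite /fps2_entry !fps2_oppE mxE.
Qed.

Lemma fps2_entry_x2e i j P :
  fps2_entry i j ((@fps2_x2e 'M[A]_n : fps2 _) * P) =
  (@fps2_x2e A : fps2 A) * fps2_entry i j P.
Proof.
apply: fps2_ext => k l; rewrite /fps2_entry !fps2_x2e_mulE !mxE.
by do 2!case: ifP => _; rewrite ?mxE.
Qed.

Definition fps2_diag (d : 'I_n -> fps2 A) : fps2 'M[A]_n :=
  fun k l => diag_mx (\row_i d i k l).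

Lemma fps2_entry_mul_diag i j P d :
  fps2_entry i j (P * fps2_diag d) = fps2_entry i j P * d j.
Proof.
apply: fps2_ext => k l; rewrite /fps2_entry !fps2_mulE summxE.
apply: eq_bigr => a _; rewrite summxE; apply: eq_bigr => b _.
by rewrite -mulmxE mul_mx_diag !mxE.
Qed.

Lemma fps2_entry_diag_mul i j P d :
  fps2_entry i j (fps2_diag d * P) = d i * fps2_entry i j P.
Proof.
apply: fps2_ext => k l; rewrite /fps2_entry !fps2_mulE summxE.
apply: eq_bigr => a _; rewrite summxE; apply: eq_bigr => b _.
by rewrite -mulmxE mul_diag_mx !mxE.
Qed.

End MatrixSeries.

(** Both monomials of [x^2 - e] have weight 2, while [d/dx] lowers the weight by at most 1;
    composing the two therefore gains 1. *)
Lemma fps2_weight_x2e (A : pzRingType) m (p : fps2 A) : fps2_weight_ge m p ->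
  fps2_weight_ge m.+2 ((@fps2_x2e A : fps2 A) * p).
Proof.
move=> p0 k l klm; rewrite fps2_x2e_mulE.
have -> : (if (1 < l)%N then p k (l - 2)%N else 0) = 0.
  case: l klm => [|[|l]] //=; rewrite subn2 !addnS => klm.
  by apply: p0.
case: k klm => [|k] /= klm; first by rewrite subr0.
by rewrite p0 ?subr0.
Qed.

Lemma fps2_weight_dx (A : pzRingType) m (p : fps2 A) : fps2_weight_ge m p ->
  fps2_weight_ge m.-1 (fps2_dx p).
Proof.
move=> p0 k l klm; rewrite /fps2_dx p0 ?mul0rn // addnS.
by case: m klm {p0}.
Qed.

Lemma fps2_weight_le (A : pzRingType) m m' (p : fps2 A) : (m' <= m)%N ->
  fps2_weight_ge m p -> fps2_weight_ge m' p.
Proof. by move=> mm p0 k l klm; apply: p0; exact: leq_trans klm mm. Qed.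

Lemma fps2_weightB (A : pzRingType) m (p q : fps2 A) :
  fps2_weight_ge m p -> fps2_weight_ge m q -> fps2_weight_ge m (p - q).
Proof.
by move=> p0 q0 k l klm; rewrite fps2_addE fps2_oppE p0 // q0 // subr0.
Qed.

Lemma fps2_dxB (A : pzRingType) (p q : fps2 A) :
  fps2_dx (p - q) = fps2_dx p - fps2_dx q :> fps2 A.
Proof.
by apply: fps2_ext => k l; rewrite /fps2_dx !(fps2_addE, fps2_oppE) mulrnBl.
Qed.

(** * Formal gauge transformations of diagonal systems *)

Section Gauge.
Variables (K : numFieldType) (n : nat).
Implicit Types (d : 'I_n -> fps2 K) (P : fps2 'M[K]_n).
Local Notation u := (@fps2_x2e 'M[K]_n : fps2 'M[K]_n).

(** With [G] and [H] as below, the equation reads [P D - D P = H P], where [D] is the diagonal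
    series of [d]. Its off-diagonal entries determine [P i j] through [H P]; on the diagonal the
    left side is 0, and it suffices that [P' i i = G P i i]. *)
Lemma diagonal_gauge_exists d (R1 R2 : fps2 'M[K]_n) :
  (forall i j, i != j -> d i 0%N 0%N != d j 0%N 0%N) ->
  exists P, (exists Q, P * Q = 1 /\ Q * P = 1) /\
    u * fps2_dx P + P * (fps2_diag d + u * R2) = (fps2_diag d + u * R1) * P.
Proof.
move=> d_neq.
have ginv (ij : 'I_n * 'I_n) :
    {g : fps2 K | ij.1 != ij.2 -> (d ij.2 - d ij.1) * g = 1}.
  (* For [i = j] the difference of eigenvalues vanishes and 0 is a mere placeholder. *)
  apply: cid; case: (eqVneq ij.1 ij.2) => [_|ij_neq]; first by exists 0.
  have c_neq0 : (d ij.2 - d ij.1) 0%N 0%N != 0.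
    by rewrite fps2_addE fps2_oppE subr_eq0 eq_sym d_neq.
  have [g [dg _]] := fps2_unit (mulVf c_neq0) (divff c_neq0).
  by exists g.
pose g i j := sval (ginv (i, j)).
have gP i j : i != j -> (d j - d i) * g i j = 1.
  by move=> ij; exact: (svalP (ginv (i, j))).
pose G P : fps2 'M[K]_n := R1 * P - P * R2.
pose H P : fps2 'M[K]_n := u * (G P - fps2_dx P).
have GB P Q : G (P - Q) = G P - G Q.
  rewrite /G mulrBr mulrBl !opprB addrACA [RHS]addrACA; congr (_ + _).
  by rewrite addrC.
have HB P Q : H (P - Q) = H P - H Q.
  rewrite /H -mulrBr GB fps2_dxB; congr (_ * _).
  by rewrite !opprB addrACA [RHS]addrACA; congr (_ + _); rewrite addrC.
have Gw m P : fps2_weight_ge m P -> fps2_weight_ge m (G P).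
  move=> P0; apply: fps2_weightB; first exact: fps2_weight_mull.
  exact: fps2_weight_mulr.
have Hw m P : fps2_weight_ge m P -> fps2_weight_ge m.+1 (H P).
  move=> P0; apply: (@fps2_weight_le _ m.-1.+2); first by case: m {P0}.
  apply: fps2_weight_x2e; apply: fps2_weightB; last exact: fps2_weight_dx.
  by apply: fps2_weight_le (Gw _ _ P0); exact: leq_pred.
(* Diagonal entries are integrated in [x] with initial value 1 at [x = 0]; the others are divided by
   the difference of eigenvalues. *)
pose Phi P : fps2 'M[K]_n := fun k l => \matrix_(i, j)
  if i == j then
    (if l is l'.+1 then G P k l' i i / l'.+1%:R else (k == 0%N)%:R)
  else (g i j * fps2_entry i j (H P)) k l.
have [P PE] : exists P, P = Phi P.
  apply: fps2_fixpoint => m P Q PQ k l klm; apply/matrixP => i j.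
  rewrite fps2_addE fps2_oppE !mxE; case: ifP => _.
    (* At [l = 0] stands the constant of integration, which is independent of [P]; at [l.+1]
       integration reads [G P] one weight lower. *)
    case: l klm => [|l] klm; first by rewrite subrr.
    rewrite addnS ltnS in klm.
    have /matrixP /(_ i i) := Gw _ _ PQ k l klm.
    rewrite GB fps2_addE fps2_oppE !mxE => e.
    by rewrite -mulrBl e mul0r.
  have -> : forall p q : fps2 K, p k l - q k l = (p - q) k l by [].
  rewrite -mulrBr -fps2_entryN -fps2_entryD -HB.
  apply: (@fps2_weight_mull _ m.+1) => // a b abm.
  by rewrite /fps2_entry (Hw m) // mxE.
exists P.
have Pdiag i k l : fps2_dx P k l i i = G P k l i i.
  rewrite /fps2_dx {1}PE mulmxnE mxE eqxx -[_ *+ _]mulr_natr divfK //.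
have Poff i j : i != j ->
    fps2_entry i j P * (d j - d i) = fps2_entry i j (H P).
  move=> ij; have -> : fps2_entry i j P = g i j * fps2_entry i j (H P).
    apply: fps2_ext => k l; rewrite /fps2_entry {1}PE mxE (negPf ij).
    by [].
  by rewrite fps2_mulC mulrA gP ?mul1r.
split.
  (* Off the diagonal the constant terms vanish, since [H P] is a multiple of [x^2 - e]. *)
  have P00 : P 0%N 0%N = 1.
    apply/matrixP => i j; rewrite PE !mxE; case: eqP => // _.
    rewrite fps2_mul00 /H fps2_entry_x2e fps2_x2e_mulE /= subr0 mulr0.
    by [].
  by apply: (@fps2_unit _ P 1); rewrite P00 mulr1.
have e : P * fps2_diag d - fps2_diag d * P = H P.
  apply: fps2_ext => k l; apply/matrixP => i j.
  rewrite -/(fps2_entry i j _ k l) -/(fps2_entry i j (H P) k l).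
  rewrite fps2_entryD fps2_entryN fps2_entry_mul_diag fps2_entry_diag_mul.
  rewrite [d i * _]fps2_mulC -mulrBr.
  case: (eqVneq i j) => [<-|ij]; last by rewrite Poff.
  rewrite subrr mulr0 /H fps2_entry_x2e.
  have -> : fps2_entry i i (G P - fps2_dx P) = 0.
    apply/eqP; rewrite fps2_entryD fps2_entryN subr_eq0; apply/eqP.
    by apply: fps2_ext => a b; rewrite /fps2_entry Pdiag.
  by rewrite mulr0.
rewrite mulrDr [RHS]mulrDl.
have -> : P * fps2_diag d = fps2_diag d * P + H P by rewrite -e addrC subrK.
rewrite addrCA -addrA; congr (_ + _).
rewrite mulrA -fps2_x2e_comm -!mulrA -!mulrDr; congr (_ * _).
by rewrite addrA subrK /G subrK.
Qed.

(** A strictly increasing self-map [f] of ['I_n] satisfies [i <= f i]; this is applied to [s] and to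
    its inverse. *)
Lemma increasing_ord_perm (s : 'S_n) :
  (forall i j : 'I_n, (i < j)%N -> (s i < s j)%N) -> forall i, s i = i.
Proof.
have incr_ge (f : 'I_n -> 'I_n) :
    (forall i j : 'I_n, (i < j)%N -> (f i < f j)%N) ->
    forall i : 'I_n, (i <= f i)%N.
  move=> f_incr i; move: {2}(nat_of_ord i) (erefl (nat_of_ord i)) => m.
  elim: m i => [|m IH] i im; first by rewrite im.
  have mn : (m < n)%N by rewrite ltnW // -im.
  rewrite im; apply: leq_ltn_trans (IH (Ordinal mn) erefl) _.
  by apply: f_incr; rewrite im.
move=> s_incr i; apply/val_inj/eqP; rewrite eqn_leq [X in _ && X]incr_ge // andbT.
rewrite -{2}(permK s i); apply: incr_ge => a b ab.
rewrite ltnNge leq_eqVlt negb_or -leqNgt; apply/andP; split.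
  by apply/negP => /eqP/val_inj/perm_inj ba; rewrite ba ltnn in ab.
rewrite leqNgt; apply/negP => /s_incr; rewrite !permKV => ba.
by have := ltn_trans ab ba; rewrite ltnn.
Qed.

(** Some term of the Leibniz expansion of the determinant is nonzero. *)
Lemma det_neq0_perm (M : 'M[K]_n) : \det M != 0 ->
  exists s : 'S_n, forall i, M i (s i) != 0.
Proof.
move=> detM.
have /existsP[s /forallP Ms] : [exists s : 'S_n, [forall i, M i (s i) != 0]].
  apply: contraNT detM => /existsPn noS.
  rewrite /determinant big1 // => s _.
  have /forallPn[i /negPn/eqP Mi0] := noS s.
  by rewrite (bigD1 i) //= Mi0 mul0r mulr0.
by exists s.
Qed.

(** The series [S] collects all that is multiplied by [x^2 - e], including the derivative of [P], so
    that the argument is purely algebraic. *)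
Lemma diagonal_gauge_unique d1 d2 (S P Q : fps2 'M[K]_n) (R : realDomainType)
    (re : K -> R) :
  (forall i k l, d1 i k l.+2 = 0) -> (forall i k l, d2 i k l.+2 = 0) ->
  (forall i j : 'I_n, (i < j)%N -> re (d1 j 0%N 0%N) < re (d1 i 0%N 0%N)) ->
  (forall i j : 'I_n, (i < j)%N -> re (d2 j 0%N 0%N) < re (d2 i 0%N 0%N)) ->
  P * Q = 1 -> P * fps2_diag d2 + u * S = fps2_diag d1 * P ->
  d1 = d2.
Proof.
move=> deg1 deg2 ord1 ord2 PQ eqP12.
have entry i j :
    fps2_entry i j P * (d1 i - d2 j) = fps2_x2e _ * fps2_entry i j S.
  rewrite mulrBr [_ * d1 i]fps2_mulC -fps2_entry_mul_diag -fps2_entry_diag_mul.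
  by rewrite -eqP12 fps2_entryD addrC addKr fps2_entry_x2e.
have entry00 i j : P 0%N 0%N i j != 0 -> d1 i 0%N 0%N = d2 j 0%N 0%N.
  move=> Pij; have /(congr1 (fun p : fps2 K => p 0%N 0%N)) := entry i j.
  rewrite fps2_mul00 fps2_x2e_mulE subr0 fps2_addE fps2_oppE => /eqP.
  by rewrite mulf_eq0 (negPf Pij) subr_eq0 => /eqP.
(* A nonzero entry of [P 0 0] matches an eigenvalue of [d1] with one of [d2]. The permutation [s]
   does so for all of them at once, and the two decreasing orders force it to be the identity. *)
have [s Ps] : exists s : 'S_n, forall i, P 0%N 0%N i (s i) != 0.
  apply: det_neq0_perm; apply/eqP => detP0.
  have /(congr1 (fun p : fps2 'M[K]_n => \det (p 0%N 0%N))) := PQ.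
  rewrite fps2_mul00 -mulmxE det_mulmx detP0 mul0r det1 => /eqP.
  by rewrite eq_sym oner_eq0.
have s1 : forall i, s i = i.
  apply: increasing_ord_perm => i j ij; rewrite ltnNge leq_eqVlt negb_or.
  apply/andP; split.
    by apply/negP => /eqP/val_inj/perm_inj ji; rewrite ji ltnn in ij.
  apply/negP => /ord2; rewrite -!(entry00 _ _ (Ps _)) => lt1.
  by have := lt_trans lt1 (ord1 _ _ ij); rewrite ltxx.
apply: funext => i; apply/eqP; rewrite -subr_eq0; apply/eqP.
have Pii := Ps i; rewrite s1 in Pii.
have [q [_ qp]] := @fps2_unit _ (fps2_entry i i P) _ (mulVf Pii) (divff Pii).
have dE : d1 i - d2 i = fps2_x2e _ * (q * fps2_entry i i S).
  by rewrite mulrA fps2_x2e_comm -mulrA -entry mulrA qp mul1r.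
(* The difference [d1 i - d2 i] has degree at most 1 in [x] and is a multiple of [x^2 - e]. *)
have qs0 : q * fps2_entry i i S = 0.
  apply: fps2_x2e_mul_eq0 => k l.
  by rewrite -dE fps2_addE fps2_oppE deg1 deg2 subr0.
by rewrite dE qs0 mulr0.
Qed.

End Gauge.

(** * Taylor expansions *)

Section Expansions.
Variable R : realType.
Local Notation C := (CC R).
Implicit Types (f g : C -> C -> C) (a b : nat -> nat -> C).

Definition partial2 a (e x : C) (N : nat) : C :=
  \sum_(k < N) \sum_(l < N) a k l * e ^+ k * x ^+ l.

Lemma sum_half_le2 N : \sum_(k < N) (2^-1 : C) ^+ k <= 2.
Proof.
suff -> : \sum_(k < N) (2^-1 : C) ^+ k = 2 - 2 * 2^-1 ^+ N.
  by rewrite gerBl mulr_ge0 ?exprn_ge0 ?invr_ge0.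
elim: N => [|N IH]; first by rewrite big_ord0 expr0 mulr1 subrr.
rewrite big_ord_recr /= IH exprS mulrA mulfV ?pnatr_eq0 // mul1r -addrA.
congr (_ + _).
by rewrite mulr_natl mulr2n opprD subrK.
Qed.

Lemma reCB (x y : C) : reC (x - y) = reC x - reC y.
Proof. by case: x y => [? ?] [? ?]. Qed.

(** A positive element of [C] is real, so the claim descends to [R], where it follows from the
    archimedean property and [N <= 2 ^ m]. *)
Lemma half_lt (eps : C) : 0 < eps ->
  exists N, forall m, (N <= m)%N -> (2^-1 : C) ^+ m < eps.
Proof.
move=> eps0.
have epsE : eps = ((complex.Re eps)%:C)%C.
  move: (gtr0_real eps0); case: eps {eps0} => x y.
  by rewrite complex_real /= => /eqP ->.
have Re0 : 0 < complex.Re eps by move: eps0; rewrite epsE ltcR.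
have [N NE] : exists N : nat, (complex.Re eps)^-1 < N%:R.
  by exists (Num.truncn (complex.Re eps)^-1).+1; exact: truncnS_gt.
exists N => m Nm.
have m2 : (N <= 2 ^ m)%N by rewrite (leq_trans Nm) // ltnW // ltn_expl.
rewrite exprVn invf_plt ?posrE ?exprn_gt0 // epsE.
rewrite -natrX -(rmorph_nat (real_complex R)) -fmorphV ltcR.
by rewrite (lt_le_trans NE) // ler_nat.
Qed.

(* Keeps unification from unfolding the modulus of R[i]. *)
Local Opaque CC.

(** The order of [C] is partial; two radii are comparable because positive elements are real. *)
Lemma common_radius (r s : C) : 0 < r -> 0 < s ->
  exists t : C, [/\ 0 < t, t <= r & t <= s].
Proof.
move=> r0 s0; have /orP[rs|sr] := real_leVge (gtr0_real r0) (gtr0_real s0).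
  by exists r.
by exists s.
Qed.

(** On at most half the radius, the bound on the coefficients acquires a geometric factor, which
    makes double sums of moduli bounded. *)
Lemma expansion2_shrink f a (s : C) : 0 < s -> expansion2 f a ->
  exists r M : C, [/\ 0 < r, r <= s, 0 <= M,
    forall k l : nat, `|a k l| * r ^+ (k + l) <= M * 2^-1 ^+ (k + l) &
    forall e x : C, `|e| < r -> `|x| < r -> partial2 a e x @ \oo --> f e x].
Proof.
move=> s0 [r [M [r0 aM f_cvg]]].
have r20 : 0 < r / 2 by rewrite divr_gt0.
have [t [t0 tr ts]] := common_radius r20 s0.
have tr1 : t <= r.
  by rewrite (le_trans tr) // ler_pdivrMr // ler_peMr ?ler1n // ltW.
exists t, M; split => //.
- by apply: le_trans (aM 0%N 0%N); rewrite mulr_ge0 ?exprn_ge0 // ltW.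
- move=> k l; apply: (@le_trans _ _ (`|a k l| * (r / 2) ^+ (k + l))).
    by rewrite ler_wpM2l // lerXn2r ?nnegrE // ltW.
  by rewrite exprMn mulrA ler_wpM2r ?exprn_ge0 ?invr_ge0.
- by move=> e x et xt; apply: f_cvg;
    [exact: lt_le_trans et tr1|exact: lt_le_trans xt tr1].
Qed.

Lemma expansion2_near f g a (s : C) : 0 < s ->
  (forall e x : C, `|e| < s -> `|x| < s -> f e x = g e x) ->
  expansion2 f a -> expansion2 g a.
Proof.
move=> s0 fg [r [M [r0 aM f_cvg]]].
have [t [t0 tr ts]] := common_radius r0 s0.
exists t, M; split => //.
- move=> k l; apply: le_trans (aM k l).
  by rewrite ler_wpM2l // lerXn2r ?nnegrE // ltW.
- move=> e x et xt; rewrite -fg ?(lt_le_trans _ ts) //.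
  by apply: f_cvg; [exact: lt_le_trans et tr|exact: lt_le_trans xt tr].
Qed.

Lemma eventually_eq_cvg (u v : nat -> C) (m : nat) (y : C) :
  (forall N, (m <= N)%N -> u N = v N) -> v @ \oo --> y -> u @ \oo --> y.
Proof.
move=> uv; apply: cvg_trans; apply: near_eq_cvg.
by exists m => // N /= mN; rewrite uv.
Qed.

Lemma expansion2D f g a b : expansion2 f a -> expansion2 g b ->
  expansion2 (fun e x => f e x + g e x) (fun k l => a k l + b k l).
Proof.
move=> [r [M [r0 aM f_cvg]]] [s [M' [s0 bM g_cvg]]].
have [t [t0 tr ts]] := common_radius r0 s0.
exists t, (M + M'); split => //.
- move=> k l; apply: le_trans (_ : (`|a k l| + `|b k l|) * t ^+ (k + l) <= _).
    by rewrite ler_wpM2r ?ler_normD // exprn_ge0 // ltW.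
  rewrite mulrDl lerD //.
    by apply: le_trans (aM k l); rewrite ler_wpM2l // lerXn2r ?nnegrE // ltW.
  by apply: le_trans (bM k l); rewrite ler_wpM2l // lerXn2r ?nnegrE // ltW.
- move=> e x et xt.
  have h : (fun N => partial2 a e x N + partial2 b e x N) @ \oo --> f e x + g e x.
    exact: cvgD (f_cvg e x (lt_le_trans et tr) (lt_le_trans xt tr))
                (g_cvg e x (lt_le_trans et ts) (lt_le_trans xt ts)).
  apply: (eventually_eq_cvg (m := 0) _ h) => N _.
  rewrite /partial2 -big_split; apply: eq_bigr => k _.
  by rewrite -big_split; apply: eq_bigr => l _; rewrite !mulrDl.
Qed.

Lemma expansion2N f a : expansion2 f a ->
  expansion2 (fun e x => - f e x) (fun k l => - a k l).
Proof.
move=> [r [M [r0 aM f_cvg]]]; exists r, M; split; first exact: r0.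
  by move=> k l; rewrite normrN; exact: aM.
move=> e x er xr.
have h : (fun N => - partial2 a e x N) @ \oo --> - f e x.
  exact: cvgN (f_cvg e x er xr).
apply: (eventually_eq_cvg (m := 0) _ h) => N _.
rewrite /partial2 -sumrN; apply: eq_bigr => k _.
by rewrite -sumrN; apply: eq_bigr => l _; rewrite !mulNr.
Qed.

Lemma expansion2_0 : expansion2 (fun _ _ => 0 : C) (fun _ _ => 0).
Proof.
exists 1, 0; split => // [k l|e x _ _]; first by rewrite normr0 mul0r.
under eq_fun do (rewrite big1; [over|
  by move=> k _; rewrite big1 // => l _; rewrite !mul0r]).
exact: cvg_cst.
Qed.

(** Square partial sums are symmetric in the two variables; multiplication by [e] is thereby reduced
    to multiplication by [x]. *)
Lemma expansion2_swap f a : expansion2 f a ->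
  expansion2 (fun e x => f x e) (fun k l => a l k).
Proof.
move=> [r [M [r0 aM f_cvg]]]; exists r, M; split; first exact: r0.
  by move=> k l; rewrite addnC; exact: aM.
move=> e x er xr.
apply: (eventually_eq_cvg (m := 0) _ (f_cvg x e xr er)) => N _.
rewrite exchange_big; apply: eq_bigr => k _; apply: eq_bigr => l _.
by rewrite mulrAC.
Qed.

Lemma expansion2_mulx f a : expansion2 f a ->
  expansion2 (fun e x => x * f e x)
    (fun k l => if (0 < l)%N then a k l.-1 else 0).
Proof.
move=> /(expansion2_shrink ltr01) [r [M [r0 r1 M0 aM f_cvg]]].
have half0 : (0 : C) <= 2^-1 by rewrite invr_ge0.
have half1 : (2^-1 : C) <= 1 by rewrite -[leRHS]invr1 lef_pV2 ?posrE ?ler1n.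
exists r, M; split; first exact: r0.
  move=> k [|l] /=; first by rewrite normr0 mul0r.
  rewrite addnS exprSr mulrA.
  apply: le_trans (_ : `|a k l| * r ^+ (k + l) <= M).
    by rewrite ler_piMr // mulr_ge0 // exprn_ge0 // ltW.
  by rewrite (le_trans (aM k l)) // ler_piMr // exprn_ile1.
move=> e x er xr; rewrite -/(partial2 _ e x) -cvg_shiftS.
(* The shift in [x] turns a square partial sum into a rectangular one: [D N] is the missing column
   [l = N], and it tends to 0 by the geometric bound. *)
pose D N := \sum_(k < N.+1) a k N * e ^+ k * x ^+ N.
have D0 : D @ \oo --> (0 : C).
  apply/cvgr0Pnorm_lt => eps eps0.
  (* [M] may be 0, hence the divisor [M + 1]. *)
  have M1 : 0 < M + 1 by rewrite ltr_wpDl.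
  have [N0 N0P] := half_lt (divr_gt0 eps0 (mulr_gt0 (ltr0Sn C 1) M1)).
  near=> N.
  have : (N0 <= N)%N by near: N; exact: nbhs_infty_ge.
  move=> /N0P; rewrite ltr_pdivlMr ?mulr_gt0 //; apply: le_lt_trans.
  apply: le_trans (ler_norm_sum _ _ _) _.
  apply: le_trans (_ : \sum_(k < N.+1) M * 2^-1 ^+ N * 2^-1 ^+ k <= _).
    apply: ler_sum => k _; rewrite !normrM !normrX -mulrA.
    rewrite -[M * _ * _]mulrA -exprD addnC.
    apply: le_trans (aM k N); rewrite ler_wpM2l // exprD.
    by rewrite ler_pM ?exprn_ge0 ?lerXn2r ?nnegrE // ltW.
  rewrite -mulr_sumr [M * _]mulrC -mulrA ler_wpM2l ?exprn_ge0 //.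
  rewrite [_ * (M + 1)]mulrC ler_pM ?sumr_ge0 ?sum_half_le2 ?lerDl // => k _;
    by rewrite exprn_ge0 // invr_ge0.
have f_cvg1 : (fun N => partial2 a e x N.+1) @ \oo --> f e x.
  by rewrite (cvg_shiftS (partial2 a e x)); exact: f_cvg.
have h : (fun N => x * (partial2 a e x N.+1 - D N)) @ \oo --> x * (f e x - 0).
  by apply: cvgMl_tmp; exact: cvgB f_cvg1 D0.
rewrite subr0 in h; apply: (eventually_eq_cvg (m := 0) _ h) => N _.
rewrite /partial2 /D -sumrB mulr_sumr.
apply: eq_bigr => k _.
rewrite [in RHS]big_ord_recr /= addrK big_ord_recl /= mul0r mul0r add0r.
by rewrite mulr_sumr; apply: eq_bigr => l _; rewrite exprS mulrCA.
Unshelve. all: by end_near.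
Qed.

Lemma expansion2_mule f a : expansion2 f a ->
  expansion2 (fun e x => e * f e x)
    (fun k l => if (0 < k)%N then a k.-1 l else 0).
Proof. by move=> /expansion2_swap /expansion2_mulx /expansion2_swap. Qed.

(** The definition of [analytic1] gives convergence only; the geometric bound comes from the
    boundedness of the terms of the series at [e = r / 2]. *)
Lemma expansion2_analytic1 (f : C -> C) : analytic1 f ->
  exists c : nat -> C, [/\ expansion2 (fun e _ => f e)
     (fun k l => if l == 0%N then c k else 0) & c 0%N = f 0].
Proof.
move=> [c [r [r0 f_cvg]]]; exists c; split.
- have r20 : 0 < r / 2 by rewrite divr_gt0.
  have r2r : r / 2 < r by rewrite ltr_pdivrMr // ltr_pMr // ltr1n.
  pose T k := c k * (r / 2) ^+ k.
  have [N0 N0P] : exists N0, forall m, (N0 <= m)%N -> `|T m| <= 1.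
    have := f_cvg (r / 2); rewrite gtr0_norm // => /(_ r2r).
    (* A term is the difference of two consecutive partial sums, each within 1/2 of the limit. The
       finitely many earlier terms are bounded by their sum. *)
    move/cvgrPdist_lt => /(_ 2^-1); rewrite invr_gt0 ltr0Sn.
    move=> /(_ isT) [N0 _ N0P].
    exists N0 => m Nm.
    have -> : T m = (f (r / 2) - [series T k]_k m) -
                    (f (r / 2) - [series T k]_k m.+1).
      rewrite opprB addrC addrA subrK /series /= big_nat_recr //=.
      by rewrite addrAC subrr add0r.
    apply: le_trans (ler_normB _ _) _; rewrite [leRHS]splitr mul1r.
    rewrite lerD // ltW //; apply: N0P => //=.
    exact: leqW.
  have bound : forall k, `|T k| <= 1 + \sum_(i < N0) `|T i|.
    move=> k; have [kN|/N0P Tk] := ltnP k N0.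
      rewrite (bigD1 (Ordinal kN)) //= addrCA lerDl addr_ge0 //.
      by rewrite sumr_ge0.
    by rewrite (le_trans Tk) // lerDl sumr_ge0.
  exists (r / 2), (1 + \sum_(i < N0) `|T i|); split => //.
    move=> k [|l] /=; last first.
      by rewrite normr0 mul0r addr_ge0 ?sumr_ge0.
    have := bound k; rewrite /T normrM [`|(r / 2) ^+ k|]gtr0_norm ?exprn_gt0 //.
    by rewrite addn0.
  move=> e x er _.
  apply: (eventually_eq_cvg (m := 1) _ (f_cvg e (lt_trans er r2r))) => N N1.
  rewrite /series /= big_mkord; apply: eq_bigr => k _.
  case: N N1 k => // N _ k.
  rewrite big_ord_recl /= expr0 mulr1 big1 ?addr0 // => l _.
  by rewrite !mul0r.
- have := f_cvg 0; rewrite normr0 => /(_ r0) f0.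
  have : [series c k * 0 ^+ k]_k @ \oo --> c 0%N.
    rewrite -cvg_shiftS.
    apply: (eventually_eq_cvg (m := 0) _ (cvg_cst (c 0%N))) => N _ /=.
    rewrite /series /= big_nat_recl // expr0 mulr1 big1 ?addr0 // => k _.
    by rewrite exprS mul0r mulr0.
  by move=> f0'; exact: (cvg_unique _ f0' f0).
Qed.

(* On the curve (e, x) = (t^(l+1), t) the monomial e^k x^l has strictly lower
   order in t than all those which follow it lexicographically. *)
Lemma expansion2_eq0 f a (s : C) : 0 < s ->
  (forall e x : C, `|e| < s -> `|x| < s -> f e x = 0) ->
  expansion2 f a -> forall k l, a k l = 0.
Proof.
move=> s0 f0 a_exp.
have s20 : 0 < s / 2 by rewrite divr_gt0.
have [s1 [s10 s1s s11]] := common_radius s20 ltr01.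
have [r [M [r0 rs1 M0 aM f_cvg]]] := expansion2_shrink s10 a_exp.
have r20 : 0 < r / 2 by rewrite divr_gt0.
have r2r : r / 2 < r by rewrite ltr_pdivrMr // ltr_pMr // ltr1n.
have r1 : r <= 1 := le_trans rs1 s11.
set t0 := r / 2.
(* Lexicographic induction: all coefficients before [(k, l)] are known to vanish. *)
elim/ltn_ind => k IHk; elim/ltn_ind => l IHl.
(* [d] is the order in [t] of [e^k x^l] on the curve. In [B], the 1 accounts for a partial sum
   smaller than [t ^+ d.+1], and [4 * M] for the later monomials, 4 bounding a double geometric sum
   of ratio 1/2. *)
pose d := (l.+1 * k + l)%N.
pose B := 1 + 4 * M * t0^-1 ^+ d.+1.
have B0 : 0 < B.
  by rewrite ltr_wpDr // !mulr_ge0 // exprn_ge0 // invr_ge0 ltW.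
have key (t : C) : 0 < t -> t <= t0 -> `|a k l| <= B * t.
  move=> tp tt0.
  have tr : t < r by exact: le_lt_trans tt0 r2r.
  have tKr : t ^+ l.+1 < r.
    apply: le_lt_trans (tr); rewrite -[leRHS]expr1 ler_wiXn2l ?(ltW tp) // ltW //.
    exact: lt_le_trans tr r1.
  have rs : r <= s.
    rewrite (le_trans rs1) // (le_trans s1s) //.
    by rewrite ler_pdivrMr // ler_peMr ?ler1n // ltW.
  have tN : `|t| = t by exact: gtr0_norm.
  have tKN : `|t ^+ l.+1| = t ^+ l.+1 by rewrite normrX tN.
  have := f_cvg (t ^+ l.+1) t; rewrite tKN tN => /(_ tKr tr).
  rewrite f0 ?tKN ?tN; first last.
  - exact: lt_le_trans tr rs.
  - exact: lt_le_trans tKr rs.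
  move/cvgr0Pnorm_lt => /(_ (t ^+ d.+1) (exprn_gt0 _ tp)) [N0 _ N0P].
  pose N := (N0 + k.+1 + l.+1)%N.
  have kN : (k < N)%N by rewrite /N addnAC leq_addl.
  have lN : (l < N)%N by rewrite /N leq_addl.
  have := N0P N; rewrite /= /N -addnA leq_addr => /(_ isT).
  rewrite addnA -/N => SN.
  pose T i j := a i j * (t ^+ l.+1) ^+ i * t ^+ j.
  (* [Z] is the family of terms with the one at [(k, l)] removed. *)
  pose Z i j := if (i == k) && (j == l) then 0 else T i j.
  have SE : partial2 a (t ^+ l.+1) t N =
      T k l + \sum_(i < N) \sum_(j < N) Z i j.
    rewrite /partial2 (bigD1 (Ordinal kN)) //= (bigD1 (Ordinal lN)) //=.
    rewrite [in RHS](bigD1 (Ordinal kN)) //= [in RHS](bigD1 (Ordinal lN)) //=.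
    rewrite {1}/Z !eqxx add0r -addrA; congr (_ + (_ + _)).
      apply: eq_bigr => j jl; rewrite /Z eqxx /= ifN //.
    apply: eq_bigr => i ik; apply: eq_bigr => j _.
    by rewrite /Z ifN // negb_and; apply/orP; left.
  have Zle i j : `|Z i j| <= (t / t0) ^+ d.+1 * M * 2^-1 ^+ i * 2^-1 ^+ j.
    have tt00 : 0 <= t / t0 by rewrite divr_ge0 // ltW.
    have RHS0 : 0 <= (t / t0) ^+ d.+1 * M * 2^-1 ^+ i * 2^-1 ^+ j.
      by rewrite !mulr_ge0 // exprn_ge0 // invr_ge0.
    rewrite /Z; case: ifPn => [_|ijkl]; first by rewrite normr0.
    have [ik|ik] := ltnP i k; first by rewrite /T IHk // !mul0r normr0.
    have [/andP[/eqP ik' jl]|ijd] := boolP ((i == k) && (j < l)%N).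
      by move: RHS0; rewrite ik' /T IHl // !mul0r normr0.
    (* A later monomial has order at least [d.+1] in [t], so a factor [(t / t0) ^+ d.+1] comes out
       and the rest is estimated at [t0]. *)
    have dij : (d < l.+1 * i + j)%N.
      rewrite /d; move: ik; rewrite leq_eqVlt => /orP[/eqP ik|ik].
        rewrite -ik eqxx /= in ijkl ijd.
        by rewrite -ik ltn_add2l ltn_neqAle eq_sym ijkl leqNgt.
      apply: leq_trans (_ : l.+1 * k.+1 <= _)%N.
        by rewrite mulnS -addnS addnC.
      by rewrite (leq_trans _ (leq_addr _ _)) // leq_mul2l.
    have t01 : t0 <= 1 by rewrite ltW // (lt_le_trans r2r).
    have TE : `|T i j| = `|a i j| * t ^+ (l.+1 * i + j).
      by rewrite /T !normrM !normrX !(gtr0_norm tp) -exprM -mulrA -exprD.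
    have tdE : t ^+ d.+1 = (t / t0) ^+ d.+1 * t0 ^+ d.+1.
      by rewrite -exprMn divfK // gt_eqF.
    rewrite TE -(subnKC dij) exprD tdE.
    rewrite mulrCA -!mulrA ler_wpM2l ?exprn_ge0 //.
    rewrite mulrCA.
    apply: le_trans (_ : `|a i j| * t0 ^+ (l.+1 * i + j) <= _).
      rewrite -[in leRHS](subnKC dij) [in leRHS]exprD.
      rewrite ler_wpM2l // ler_wpM2l ?exprn_ge0 ?(ltW r20) //.
      by rewrite lerXn2r ?nnegrE ?(ltW tp) ?(ltW r20).
    apply: le_trans (_ : `|a i j| * r ^+ (i + j) <= _); last first.
      by rewrite -exprD; exact: aM.
    rewrite ler_wpM2l //; apply: le_trans (_ : t0 ^+ (i + j) <= _).
      by rewrite ler_wiXn2l ?(ltW r20) // leq_add2r leq_pmull.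
    by rewrite lerXn2r ?nnegrE ?ltW.
  have sumZ : `|\sum_(i < N) \sum_(j < N) Z i j| <= (t / t0) ^+ d.+1 * M * 4.
    apply: le_trans (ler_norm_sum _ _ _) _.
    apply: le_trans (_ : \sum_(i < N) (t / t0) ^+ d.+1 * M * 2^-1 ^+ i * 2 <= _).
      apply: ler_sum => i _; apply: le_trans (ler_norm_sum _ _ _) _.
      apply: (@le_trans _ _ (\sum_(j < N)
        (t / t0) ^+ d.+1 * M * 2^-1 ^+ i * 2^-1 ^+ j)).
        by apply: ler_sum => j _; exact: Zle.
      rewrite -mulr_sumr ler_wpM2l ?sum_half_le2 //.
      rewrite !mulr_ge0 ?exprn_ge0 ?invr_ge0 //.
      by rewrite divr_ge0 // ltW.
    rewrite -mulr_suml -mulr_sumr -mulrA ler_wpM2l //.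
      by rewrite !mulr_ge0 ?exprn_ge0 ?divr_ge0 // ltW.
    have -> : (4 : C) = 2 * 2 by rewrite -natrM.
    by rewrite ler_wpM2r ?sum_half_le2.
  have : `|a k l| * t ^+ d <= B * t * t ^+ d.
    have -> : `|a k l| * t ^+ d = `|T k l|.
      by rewrite /T !normrM !normrX !(gtr0_norm tp) -exprM -mulrA -exprD.
    have -> : T k l = partial2 a (t ^+ l.+1) t N -
        \sum_(i < N) \sum_(j < N) Z i j.
      by rewrite SE addrK.
    apply: le_trans (ler_normB _ _) _.
    apply: le_trans (lerD (ltW SN) sumZ) _.
    rewrite -[leRHS]mulrA -[in leRHS]exprS /B mulrDl mul1r lerD2l exprMn.
    by rewrite -[leLHS]mulrA [M * 4]mulrC [leLHS]mulrC [t ^+ _ * _]mulrC mulrA.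
  by rewrite ler_pM2r // exprn_gt0.
apply/eqP; rewrite -normr_eq0; apply/negPn/negP => a_neq0.
have a_gt0 : 0 < `|a k l| by rewrite lt_def a_neq0 normr_ge0.
(* With [t] at most [|a k l| / (2 B)], [key] would bound [|a k l|] by its own half. *)
have [t [tp tt0 tle]] :=
  common_radius r20 (divr_gt0 a_gt0 (mulr_gt0 (ltr0Sn C 1) B0)).
have := le_trans (key t tp tt0) (ler_wpM2l (ltW B0) tle).
rewrite invfM [2^-1 * _]mulrC mulrCA mulVKf ?gt_eqF //.
rewrite ler_pdivlMr //.
by rewrite ger_pMr // (ler_nat C 2 1).
Qed.

Lemma expansion2_unique f g a b (s : C) : 0 < s ->
  (forall e x : C, `|e| < s -> `|x| < s -> f e x = g e x) ->
  expansion2 f a -> expansion2 g b -> a = b.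
Proof.
move=> s0 fg fa gb; apply: funext => k; apply: funext => l.
apply/eqP; rewrite -subr_eq0; apply/eqP.
apply: (expansion2_eq0 s0 _ (expansion2D fa (expansion2N gb))) => e x es xs.
by rewrite fg // subrr.
Qed.

Lemma expansion2_inj f g a : expansion2 f a -> expansion2 g a ->
  exists2 s : C, 0 < s &
    forall e x : C, `|e| < s -> `|x| < s -> f e x = g e x.
Proof.
move=> [r [_ [r0 _ f_cvg]]] [r' [_ [r'0 _ g_cvg]]].
have [s [s0 sr sr']] := common_radius r0 r'0.
exists s => // e x es xs.
have fe := f_cvg e x (lt_le_trans es sr) (lt_le_trans xs sr).
have ge := g_cvg e x (lt_le_trans es sr') (lt_le_trans xs sr').
exact: cvg_unique fe ge.
Qed.

End Expansions.

(** * Prenormal families *)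

Section Classification.
Variables (R : realType) (n : nat).
Local Notation C := (CC R).
Local Notation u := (@fps2_x2e 'M[C]_n : fps2 'M[C]_n).
Implicit Types F : prenormal_family R n.

Lemma prenormal_expansion F :
  exists (d : 'I_n -> fps2 C) (rem : fps2 'M[C]_n),
  [/\ forall i, expansion2 (fun e x => (lambda F i e).[x]) (d i),
      mx_expansion2 (family_system F) (fps2_diag d + u * rem),
      forall i k l, d i k l.+2 = 0 &
      forall i, d i 0%N 0%N = (lambda F i 0).[0]].
Proof.
have lambdaE i e x : (lambda F i e).[x] = lam0 F i e + x * lam1 F i e.
  by rewrite /lambda /lambda_poly hornerD hornerC hornerZ hornerX mulrC.
have c0P i := cid (expansion2_analytic1 (lam0_analytic F i)).
have c1P i := cid (expansion2_analytic1 (lam1_analytic F i)).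
have rP i j := cid (remainder_analytic F i j).
(* The nested conditionals have the shape that [expansion2_mulx] produces for [x * lam1]. *)
pose d i : fps2 C := fun k l => (if l == 0%N then sval (c0P i) k else 0) +
  (if (0 < l)%N then if l.-1 == 0%N then sval (c1P i) k else 0 else 0).
have d_exp i : expansion2 (fun e x => (lambda F i e).[x]) (d i).
  have [c0_exp _] := svalP (c0P i).
  have [/expansion2_mulx c1_exp _] := svalP (c1P i).
  apply: expansion2_near (ltr01) _ (expansion2D c0_exp c1_exp) => e x _ _.
  by rewrite lambdaE.
pose rem : fps2 'M[C]_n := fun k l => \matrix_(i, j) sval (rP i j) k l.
exists d, rem; split => //.
- move=> i j.
  have r_exp : expansion2 (fun e x => remainder F e x i j) (sval (rP i j)).
    exact: svalP (rP i j).
  have diag_exp : expansion2 (fun e x => (lambda F i e).[x] *+ (i == j))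
      (fun k l => d i k l *+ (i == j)).
    case: (i == j); first exact: d_exp.
    exact: expansion2_0.
  (* The factor [x^2 - e] is applied as two multiplications by [x] minus one by [e]. *)
  have ur_exp := expansion2D (expansion2_mulx (expansion2_mulx r_exp))
    (expansion2N (expansion2_mule r_exp)).
  have := expansion2_near ltr01 _ (expansion2D diag_exp ur_exp).
  move=> /(_ (fun e x => family_system F e x i j)).
  set a := (X in expansion2 _ X).
  have -> : (fun k l => (fps2_diag d + u * rem) k l i j) = a.
    apply: funext => k; apply: funext => l.
    rewrite /a fps2_addE fps2_x2e_mulE !mxE; congr (_ + _).
    case: l => [|[|l]]; case: k => [|k] /=;
      by rewrite ?mxE ?subr0 ?subn2 ?oppr0 ?addr0.
  apply => e x _ _.
  by rewrite !mxE mulrBl expr2 mulrA.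
- by move=> i k l; rewrite /d /= addr0.
- move=> i; rewrite lambdaE mul0r addr0 /d /= addr0.
  by have [] := svalP (c0P i).
Qed.

Lemma lambda_re_decreasing F (i j : 'I_n) : (i < j)%N ->
  reC (lambda F j 0).[0] < reC (lambda F i 0).[0].
Proof. by move=> /(lam_ordered F); rewrite reCB subr_gt0. Qed.

Lemma near0P (P : C -> Prop) : (\forall e \near (0 : C), P e) <->
  exists2 s : C, 0 < s & forall e, `|e| < s -> P e.
Proof. exact: nbhs_norm0P. Qed.

Lemma near00P (P : C -> C -> Prop) :
  (\forall p \near ((0, 0) : C * C), P p.1 p.2) <->
  exists2 s : C, 0 < s & forall e x, `|e| < s -> `|x| < s -> P e x.
Proof.
split.
  case=> -[A B] /= [/near0P[s s0 sA] /near0P[t t0 tB]] AB.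
  have [r [r0 rs rt]] := common_radius s0 t0.
  exists r => // e x er xr; apply: (AB (e, x)); split => /=.
    by apply: sA; exact: lt_le_trans er rs.
  by apply: tB; exact: lt_le_trans xr rt.
case=> s s0 sP; exists ([set e : C | `|e| < s], [set x : C | `|x| < s]) => /=.
  by split; apply/near0P; exists s.
by case=> e x [/= es xs]; exact: sP.
Qed.

Lemma formally_equivalent_invariants F1 F2 :
  formally_equivalent (family_system F1) (family_system F2) ->
  same_invariants F1 F2.
Proof.
move=> [b1 [b2 [b1_exp b2_exp [P [[Q [PQ _]] eqP]]]]].
have [d1 [r1 [d1_exp B1_exp deg1 d1_0]]] := prenormal_expansion F1.
have [d2 [r2 [d2_exp B2_exp deg2 d2_0]]] := prenormal_expansion F2.
(* Formal equivalence supplies some Taylor expansions; uniqueness identifies them with those of the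
   form [D + u R]. *)
have uniq B (b b' : fps2 'M[C]_n) :
    mx_expansion2 B b -> mx_expansion2 B b' -> b = b'.
  move=> Bb Bb'; apply: fps2_ext => k l; apply/matrixP => i j.
  have /(congr1 (fun a => a k l)) := expansion2_unique ltr01
    (fun _ _ _ _ => erefl) (Bb i j) (Bb' i j).
  by [].
have b1E := uniq _ _ _ b1_exp B1_exp; have b2E := uniq _ _ _ b2_exp B2_exp.
have PQ1 : P * Q = 1 by apply: fps2_ext => k l; exact: PQ.
have eqP' : u * fps2_dx P + P * b2 = b1 * P.
  by apply: fps2_ext => k l; exact: eqP.
have d12 : d1 = d2.
  apply: (@diagonal_gauge_unique _ _ d1 d2 (fps2_dx P + P * r2 - r1 * P) P Q
    _ (@reC R)) => // [i j ij|i j ij|].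
  - by rewrite !d1_0 lambda_re_decreasing.
  - by rewrite !d2_0 lambda_re_decreasing.
  - move: eqP'; rewrite b1E b2E mulrDr [RHS]mulrDl => eqP'.
    apply: (addIr (u * r1 * P)); rewrite -eqP' -addrA -[u * r1 * P]mulrA.
    rewrite -[X in _ + X = _]mulrDr subrK mulrDr addrCA; congr (_ + (_ + _)).
    by rewrite !mulrA fps2_x2e_comm.
(* From equal series back to equal germs: the two polynomials of degree 1 are compared at [x = 0]
   and at [x = s / 2]. *)
move=> i; have [s s0 s_eq] := expansion2_inj (d1_exp i) (eq_ind_r
  (fun d => expansion2 _ (d i)) (d2_exp i) d12).
apply/near0P; exists s => // e es.
have lambdaE F x : (lambda F i e).[x] = lam0 F i e + lam1 F i e * x.
  by rewrite /lambda /lambda_poly hornerD hornerC hornerZ hornerX.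
have eq0 : lam0 F1 i e = lam0 F2 i e.
  by have := s_eq e 0 es; rewrite normr0 !lambdaE !mulr0 !addr0 => ->.
have s20 : 0 < s / 2 by rewrite divr_gt0.
have eq1 : lam1 F1 i e = lam1 F2 i e.
  have := s_eq e (s / 2) es; rewrite gtr0_norm // ltr_pdivrMr // ltr_pMr //.
  rewrite ltr1n => /(_ isT); rewrite !lambdaE eq0 => /addrI.
  by apply: mulIf; rewrite gt_eqF.
by rewrite /lambda /lambda_poly eq0 eq1.
Qed.

Lemma invariants_same_model F1 F2 : same_invariants F1 F2 ->
  same_family (model_system F1) (model_system F2).
Proof.
(* The index set is finite, so one neighbourhood of 0 serves all [i]. *)
move=> inv; have /near0P[s s0 s_eq] :
    \forall e \near (0 : C), forall i, lambda F1 i e = lambda F2 i e.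
  exact: (@filter_forall _ _ (fun i e => lambda F1 i e = lambda F2 i e) _
    (nbhs_filter (0 : C)) inv).
apply/(near00P (fun e x => model_system F1 e x = model_system F2 e x)).
exists s => // e x es _.
by congr diag_mx; apply/rowP => i; rewrite !mxE s_eq.
Qed.

Lemma same_model_formally_equivalent F1 F2 :
  same_family (model_system F1) (model_system F2) ->
  formally_equivalent (family_system F1) (family_system F2).
Proof.
move=> /(near00P (fun e x => model_system F1 e x = model_system F2 e x)).
move=> [s s0 s_eq].
have [d1 [r1 [d1_exp B1_exp _ d1_0]]] := prenormal_expansion F1.
have [d2 [r2 [d2_exp B2_exp _ _]]] := prenormal_expansion F2.
have d12 : d1 = d2.
  apply: funext => i; apply: (expansion2_unique s0 _ (d1_exp i) (d2_exp i)).
  move=> e x es xs; have /matrixP/(_ i i) := s_eq e x es xs.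
  by rewrite !mxE eqxx.
(* Eigenvalues at the origin are distinct because their real parts are strictly decreasing. *)
have d_neq i j : i != j -> d1 i 0%N 0%N != d1 j 0%N 0%N.
  move=> ij; apply/eqP; rewrite !d1_0 => e.
  have := ij; rewrite -val_eqE neq_ltn => /orP[] /(lambda_re_decreasing F1).
    by rewrite e ltxx.
  by rewrite e ltxx.
have [P [[Q [PQ QP]] eqP]] := diagonal_gauge_exists r1 r2 d_neq.
exists (fps2_diag d1 + u * r1), (fps2_diag d2 + u * r2); split => //.
exists P; split; last first.
  move=> k l; rewrite -d12.
  by rewrite -[RHS]/(((fps2_diag d1 + u * r1) * P) k l) -eqP.
exists Q; split => k l; first by rewrite -[LHS]/((P * Q) k l) PQ.
by rewrite -[LHS]/((Q * P) k l) QP.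
Qed.

End Classification.

Theorem theorem4p4 (R : realType) (n : nat) :
  (forall F1 F2 : prenormal_family R n,
     formally_equivalent (family_system F1) (family_system F2)
     <-> same_family (model_system F1) (model_system F2))
  /\
  (forall F1 F2 : prenormal_family R n,
     formally_equivalent (family_system F1) (family_system F2)
     <-> same_invariants F1 F2).
Proof.
(* Both equivalences come from one cycle: formal equivalence, equal invariants, equal model systems,
   formal equivalence. *)
split=> F1 F2; split.
- by move=> /formally_equivalent_invariants/invariants_same_model.
- exact: same_model_formally_equivalent.
- exact: formally_equivalent_invariants.
- by move=> /invariants_same_model/same_model_formally_equivalent.
Qed.
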